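(* Let $T$ be a tree, let $f:T\to T$ be a continuous map, and let $A\in \mathrm{Con}(T)$ contain a periodic point of $f$. Then $A$ is asymptotically periodic under $f$; that is, there is an integer $p\ge 1$ such that the sequence $\{f^{pn}(A)\}_{n\ge 0}$ converges in $\mathrm{Con}(T)$.
   Context: An interval is any space homeomorphic to $[0,1]\subset\mathbb{R}$. A tree is a (metrizable) uniquely arcwise connected space that is either a single point or a union of finitely many intervals. A continuum is a nonempty compact connected metric space. $\mathrm{Con}(T)$ denotes the set of all subcontinua of $T$ (including singletons), endowed with the topology induced by the Hausdorff metric (for any compatible metric on $T$). A point $x$ is periodic under $f$ if $f^k(x)=x$ for some $k\ge1$. *)

(* Defs.v *)
From HB Require Import structures.
From mathcomp Require Import all_boot all_order all_algebra.
From mathcomp Require Import all_classical all_reals all_analysis.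

Set Implicit Arguments.
Unset Strict Implicit.
Unset Printing Implicit Defensive.

Import Order.TTheory GRing.Theory Num.Theory.
Import numFieldNormedType.Exports.

Local Open Scope classical_set_scope.
Local Open Scope ring_scope.

(* [g] restricts to a homeomorphism from the subspace [A] onto the subspace
   [B]; the values of [g] and of the inverse [h] outside [A] and [B] are
   irrelevant. *)
Definition homeomorphism_on (X Y : topologicalType) (A : set X) (B : set Y)
    (g : X -> Y) : Prop :=
  [/\ set_bij A B g, {within A, continuous g} &
      exists2 h : Y -> X, {within B, continuous h} & {in A, cancel g h}].

(* A space homeomorphic to [0, 1]; the library's [is_interval] is the
   order-convexity of a set of reals. *)
Definition topological_interval (R : realType) (T : topologicalType)
    (I : set T) : Prop :=
  exists g : R -> T, homeomorphism_on (`[0, 1] : set R) I g.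

Definition arc_between (R : realType) (T : topologicalType) (x y : T)
    (I : set T) : Prop :=
  exists g : R -> T, [/\ homeomorphism_on (`[0, 1] : set R) I g, g 0 = x & g 1 = y].

(* Uniqueness is that of the arc as a set, not of its parametrization. *)
Definition uniquely_arcwise_connected (R : realType) (T : topologicalType)
    : Prop :=
  forall x y : T, x <> y -> exists! I : set T, arc_between R x y I.

(* Metrizability is not part of this predicate: it is meant for the underlying
   space of a [metricType]. *)
Definition is_tree (R : realType) (T : topologicalType) : Prop :=
  uniquely_arcwise_connected R T /\
  ((exists x : T, [set: T] = [set x]) \/
   exists F : set (set T),
     [/\ finite_set F, F !=set0, forall I, F I -> topological_interval R I
       & \bigcup_(I in F) I = [set: T]]).

(* Membership in Con(T). *)
Definition subcontinuum (T : topologicalType) (A : set T) : Prop :=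
  [/\ A !=set0, compact A & connected A].

(* [sup] and [inf] are real-valued, hence meaningful here only when [A] and [B]
   are nonempty and bounded, e.g. for subcontinua. *)
Definition hausdorff_dist (R : realType) (T : metricType R) (A B : set T) : R :=
  Num.max (sup [set inf [set mdist a b | b in B] | a in A])
          (sup [set inf [set mdist a b | a in A] | b in B]).

(* Convergence in Con(T): the limit has to be a subcontinuum. *)
Definition converges_in_Con (R : realType) (T : metricType R)
    (u : nat -> set T) : Prop :=
  exists2 B : set T, subcontinuum B &
    (fun n => hausdorff_dist (u n) B) @ \oo --> (0 : R).

Definition periodic_point (T : Type) (f : T -> T) (x : T) : Prop :=
  exists2 k : nat, (1 <= k)%N & iter k f x = x.

Definition asymptotically_periodic (R : realType) (T : metricType R)
    (f : T -> T) (A : set T) : Prop :=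
  exists2 p : nat, (1 <= p)%N &
    converges_in_Con (fun n => iter (p * n) f @` A).

(* Main.v *)
Require Import Defs.
From HB Require Import structures.
From mathcomp Require Import all_boot all_order all_algebra.
From mathcomp Require Import all_classical all_reals all_analysis.
From mathcomp Require Import zify lra.
Import Order.TTheory GRing.Theory Num.Theory.
Import numFieldNormedType.Exports.

Set Implicit Arguments.
Unset Strict Implicit.
Unset Printing Implicit Defensive.

Local Open Scope classical_set_scope.
Local Open Scope ring_scope.

(** The proof reduces the dynamics on subcontinua to a finite combinatorial
    system.

    After passing to an iterate, the periodic point becomes a fixed point x,
    so that every A_n = f^n(A) is a subcontinuum containing x.  Finitely many
    arcs issuing from x, the spokes, cover the tree (spoke_cover), and a
    subcontinuum containing x meets each spoke in an initial segment, because a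
    connected set containing two points contains the arc between them
    (arc_sub_connected).  Hence A_n is encoded by finitely many numbers, its
    extents r_n(j) in [0, 1], and A_n depends continuously on them
    (cvg_star).

    The tip of A_(n+1) on the spoke i is the image of one point of A_n, lying
    on one spoke j.  Any A_n' reaching at least as far as A_n on j contains
    that point, so A_(n'+1) reaches at least as far as A_(n+1) on i.  This
    property, that every (n+1, i) has a dominating predecessor (n, j), is all
    that is needed to see that r_(pn)(i) converges for p = m!, where m is the
    number of spokes.  Indeed, follow dominating predecessors backwards from
    (n, i).  Spokes repeat along this path within any m steps.  If the extent
    does not decrease between two such visits to the same spoke, repeating that
    loop of the path any number of times shows that r_(n+qp)(i) >= r_n(i)
    for all q.  If it decreases along all such loops, then cutting out enough
    loops of a common length, of total length p, shows that
    r_(n-p)(i) >= r_n(i) (pump_or_excise).  A bounded sequence each of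
    whose terms is either a lower bound of all later terms or at most its
    predecessor converges (cvgn_floor_or_descent). *)

(** * Systems with dominating predecessors *)

Section DominatingPredecessors.
Local Open Scope nat_scope.
Context {disp : Order.disp_t} {V : orderType disp} {I : finType}.
Variable x : nat -> I -> V.
Hypothesis pred_ex : forall n i, exists j, forall n',
  (x n j <= x n' j)%O -> (x n.+1 i <= x n'.+1 i)%O.

(** The points (k, s k) form the backward path from (n, i) through dominating
    predecessors. *)
Lemma backward_path n i : exists s : nat -> I, s n = i /\
  forall k, k < n -> forall n', (x k (s k) <= x n' (s k))%O ->
    (x k.+1 (s k.+1) <= x n'.+1 (s k.+1))%O.
Proof.
elim: n i => [|n IHn] i; first by exists (fun=> i).
have [j hj] := pred_ex n i; have [s [sn hs]] := IHn j.
exists (fun k => if k == n.+1 then i else s k); split; first by rewrite eqxx.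
move=> k; rewrite ltnS leq_eqVlt => /orP[/eqP->|kn] n'.
  by rewrite eqxx ltn_eqF// sn; exact: hj.
by rewrite !ltn_eqF ?ltnS// 1?ltnW//; exact: hs.
Qed.

Section AlongPath.
Variables (n : nat) (s : nat -> I).
Hypothesis path_s : forall k, k < n -> forall n',
  (x k (s k) <= x n' (s k))%O -> (x k.+1 (s k.+1) <= x n'.+1 (s k.+1))%O.

Lemma path_transport k d n' : k + d <= n ->
  (x k (s k) <= x n' (s k))%O ->
  (x (k + d) (s (k + d)) <= x (n' + d) (s (k + d)))%O.
Proof.
elim: d => [|d IHd]; first by rewrite !addn0.
rewrite !addnS => kdn h; apply: path_s => //; apply: IHd => //; exact: ltnW.
Qed.

(** A loop of the path that does not lose height can be run again and again:
    each run starts at least as high as the previous one did. *)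
Lemma path_pump k c q : k + c <= n -> s (k + c) = s k ->
  (x k (s k) <= x (k + c) (s k))%O ->
  (x n (s n) <= x (n + q * c) (s n))%O.
Proof.
move=> kcn sk up; have kn : k <= n by lia.
suff h : (x k (s k) <= x (k + q * c) (s k))%O.
  have -> : n + q * c = (k + q * c) + (n - k) by lia.
  rewrite -[X in x X (s X)](subnKC kn) -[in s n](subnKC kn).
  by apply: path_transport => //; rewrite subnKC.
elim: q => [|q IHq]; first by rewrite mul0n addn0.
rewrite mulSn (addnC c) addnA; apply: (le_trans up).
by rewrite -{1 2}sk; apply: path_transport.
Qed.

(** The height reached by the path at time k is already reached, at the same
    index, d steps earlier.  The conjunct d <= k keeps the truncated subtraction
    honest. *)
Definition delayed k d := (d <= k) && (x k (s k) <= x (k - d) (s k))%O.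

Lemma delayed_leq k l d : k <= l <= n -> delayed k d -> delayed l d.
Proof.
case/andP=> kl ln /andP[dk h]; rewrite /delayed (leq_trans dk kl)/=.
have -> : l - d = (k - d) + (l - k) by lia.
rewrite -[X in x X (s X)](subnKC kl) -[in s l](subnKC kl).
by apply: path_transport => //; rewrite subnKC.
Qed.

(** Cutting out a loop that loses height makes the path arrive earlier by the
    length of the loop, and no lower. *)
Lemma delayed_excise k c d : s (k + c) = s k ->
  (x (k + c) (s k) <= x k (s k))%O -> delayed k d -> delayed (k + c) (d + c).
Proof.
move=> sk down /andP[dk h]; rewrite /delayed leq_add2r dk/= subnDr sk.
exact: le_trans h.
Qed.

(** Pigeonhole on the #|I| + 1 times a, ..., a + #|I|.  The length of the loop
    is written c.+1, with c an ordinal, so that the possible lengths form a finite type. *)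
Lemma window_repeat a : exists k, exists2 c : 'I_#|I|,
  a <= k /\ k + c.+1 <= a + #|I| & s (k + c.+1) = s k.
Proof.
have [u [v [uv vm suv]]] :
    exists u v, [/\ u < v, v <= #|I| & s (a + u) = s (a + v)].
  have /injectivePn[u [v uv suv]] :
      ~~ injectiveb (fun w : 'I_#|I|.+1 => s (a + w)).
    by apply/negP => /injectiveP/leq_card; rewrite card_ord ltnn.
  have [ltuv|ltvu|/val_inj/eqP] := ltngtP u v; last by rewrite (negbTE uv).
    by exists u, v; split=> //; rewrite -ltnS.
  by exists v, u; split=> //; rewrite -ltnS.
have cI : (v - u).-1 < #|I|.
  by rewrite prednK ?subn_gt0// (leq_trans (leq_subr u v)).
exists (a + u), (Ordinal cI);
  rewrite /= prednK ?subn_gt0// -addnA (subnKC (ltnW uv)) //.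
by rewrite leq_add2l leq_addr.
Qed.

End AlongPath.

(** If no loop of length at most #|I| can be pumped, all of them lose height and
    can be cut out.  One loop is found in each of p * #|I| disjoint windows, so
    some length c occurs at least p times, and cutting out p / c loops of that
    length gains exactly p steps. *)
Lemma pump_or_excise p n i : (forall c, 0 < c <= #|I| -> c %| p) ->
  p * #|I| * #|I| <= n ->
  (forall q, (x n i <= x (n + q * p) i)%O) \/ (x n i <= x (n - p) i)%O.
Proof.
set m := #|I| => dvd_p len; have [s [<- path_s]] := backward_path n i.
have [[k [c [/andP[c0 cm] kcn sk up]]]|noup] := pselect (exists k c,
    [/\ 0 < c <= m, k + c <= n, s (k + c) = s k &
        (x k (s k) <= x (k + c) (s k))%O]).
  left=> q; have /dvdnP[e ->] : c %| p by apply: dvd_p; rewrite c0.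
  by rewrite mulnA; exact: (path_pump path_s _ kcn).
right.
have down k (c : 'I_m) : k + c.+1 <= n -> s (k + c.+1) = s k ->
    (x (k + c.+1) (s k) <= x k (s k))%O.
  move=> kcn sk; have [//|/ltW up] := leP (x (k + c.+1) (s k)) (x k (s k)).
  by case: noup; exists k, c.+1; split=> //; exact: ltn_ord.
have [pos [cyc posP]] : exists pos (cyc : nat -> 'I_m), forall w,
    [/\ w * m <= pos w, pos w + (cyc w).+1 <= w.+1 * m &
        s (pos w + (cyc w).+1) = s (pos w)].
  have /choice[f fP] : forall w, exists kc : nat * 'I_m,
      [/\ w * m <= kc.1, kc.1 + kc.2.+1 <= w.+1 * m &
          s (kc.1 + kc.2.+1) = s kc.1].
    move=> w; have [k [c [wk kc] sk]] := window_repeat s (w * m).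
    by exists (k, c); rewrite mulSn (addnC m).
  by exists (fun w => (f w).1), (fun w => (f w).2).
(* Number of loops of length c.+1 found in the first w windows. *)
pose num c w := \sum_(v < w) (cyc v == c).
have delayed_num w c j : w * m <= n -> j <= num c w ->
    delayed s (w * m) (j * c.+1).
  elim: w j => [|w IHw] j wn.
    by rewrite /num big_ord0 leqn0 => /eqP->; rewrite /delayed !mul0n subn0 lexx.
  have [le_w le_Sw sw] := posP w.
  have wn' : w * m <= n by apply: leq_trans wn; rewrite leq_mul2r leqnSn orbT.
  rewrite /num big_ord_recr/=; have [cwc|_] := eqVneq; last first.
    rewrite addn0 => /(IHw _ wn'); apply: (delayed_leq path_s).
    by rewrite wn leq_mul2r leqnSn orbT.
  case: j => [_|j]; first by rewrite /delayed !mul0n subn0 lexx.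
  rewrite addn1 ltnS => /(IHw _ wn') dw.
  have dpos : delayed s (pos w) (j * c.+1).
    apply: (delayed_leq path_s) dw; rewrite le_w/=.
    by rewrite (leq_trans _ wn)// (leq_trans _ le_Sw)// leq_addr.
  apply: (delayed_leq path_s (k := pos w + c.+1)); first by rewrite -cwc le_Sw.
  rewrite mulSnr; apply: delayed_excise => //; rewrite -?cwc//.
  by apply: down => //; exact: leq_trans wn.
have [c pc] : exists c, p <= num c (p * m).
  apply/not_existsP => lt_p.
  have sum_num : \sum_(c < m) num c (p * m) = p * m.
    rewrite exchange_big/= -[RHS]muln1 -[in RHS](card_ord (p * m)) -sum_nat_const.
    apply: eq_bigr => v _; rewrite (bigD1 (cyc v))//= eqxx big1 ?addn0// => c.
    by rewrite eq_sym => /negbTE->.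
  have m0 : 0 < m by rewrite /m; apply/card_gt0P; exists (s n).
  have : \sum_(c < m) (num c (p * m) + 1) <= \sum_(c < m) p.
    by apply: leq_sum => c _; rewrite addn1 ltnNge; apply/negP/lt_p.
  rewrite big_split/= sum_num !sum_nat_const card_ord muln1 (mulnC m).
  by rewrite -[leqRHS]addn0 leq_add2l leqNgt m0.
have cp : c.+1 %| p by apply: dvd_p; rewrite ltn_ord.
have := delayed_num (p * m) c (p %/ c.+1) len.
rewrite divnK// (leq_trans (leq_div _ _) pc) => /(_ isT).
move=> /(delayed_leq path_s (l := n)); rewrite len leqnn => /(_ isT).
by case/andP.
Qed.
End DominatingPredecessors.

(** Call k a floor if y k is a lower bound of all later terms.  Without floors
    beyond K the sequence is eventually nonincreasing.  Otherwise it never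
    exceeds the supremum of the values at floors once a floor has occurred, since
    a term that is not a floor is at most its predecessor; and it stays above
    each of these values after the corresponding floor. *)
Lemma cvgn_floor_or_descent (R : realType) (y : nat -> R) (M : R) (K : nat) :
  (forall k, `|y k| <= M) ->
  (forall k, (K <= k)%N ->
     (forall q, y k.+1 <= y (k.+1 + q)%N) \/ y k.+1 <= y k) ->
  cvgn y.
Proof.
move=> yM step.
pose floor := [set k | (K <= k)%N /\ forall q, y k <= y (k + q)%N].
have [[k0 fk0]|no_floor] := pselect (floor !=set0); last first.
  apply/cvg_ex; exists (inf (range (fun n => y (n + K.+1)%N))).
  rewrite -(cvg_shiftn K.+1); apply: nonincreasing_cvgn.
    apply/nonincreasing_seqP => n /=; rewrite addSn.
    have [] := step (n + K.+1)%N _; [lia| |by []].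
    move=> h; exfalso; apply: no_floor; exists (n + K.+1).+1; split=> //; lia.
  exists (- M) => _ [n _ <-].
  by move: (yM (n + K.+1)%N); rewrite ler_norml => /andP[].
have ubf : has_sup (y @` floor).
  split; first by exists (y k0), k0.
  by exists M => _ [n _ <-]; move: (yM n); rewrite ler_norml => /andP[].
have ley n : y (k0 + n)%N <= sup (y @` floor).
  elim: n => [|n IHn].
    by rewrite addn0; apply: ub_le_sup; [case: ubf|exists k0].
  rewrite addnS; have [||h] := step (k0 + n)%N.
  - by case: fk0; lia.
  - move=> h; apply: ub_le_sup; first by case: ubf.
    by exists (k0 + n).+1 => //; split=> //; case: fk0; lia.
  - exact: le_trans IHn.
apply/cvg_ex; exists (sup (y @` floor)); apply/cvgrPdist_le => e e0.
have [_ [k [Kk fk] <-] ek] := sup_adherent e0 ubf.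
exists (k + k0)%N => //= n /= kn.
have := ley (n - k0)%N; have := fk (n - k)%N.
rewrite !subnKC; try lia.
by move=> ? ?; rewrite ger0_norm; lra.
Qed.

Lemma cvgn_dominating_pred (R : realType) (I : finType) (x : nat -> I -> R) (M : R)
    (i : I) :
  (forall n j, `|x n j| <= M) ->
  (forall n i, exists j, forall n', x n j <= x n' j -> x n.+1 i <= x n'.+1 i) ->
  cvgn (fun k => x ((#|I|)`! * k)%N i).
Proof.
move=> xM pred_ex.
apply: (@cvgn_floor_or_descent _ _ M (#|I| * #|I|)%N) => // k Kk.
have div_fact c : (0 < c <= #|I|)%N -> (c %| (#|I|)`!)%N by apply: dvdn_fact.
have [|h|h] := pump_or_excise pred_ex (n := ((#|I|)`! * k.+1)%N) i div_fact.
- by rewrite -mulnA leq_mul2l (leq_trans Kk)// orbT.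
- by left=> q; rewrite mulnDr (mulnC _ q).
- by right; move: h; rewrite mulnS addnC addnK addnC.
Qed.

(** * Arcs as injective paths *)

Section Paths.
Context {R : realType} {T : metricType R}.
Implicit Types (x y z : T) (c : R -> T).

Lemma continuous_affine (k m : R) : continuous (fun t : R => k * t + m).
Proof. by move=> t; apply: cvgD; [apply: cvgZr|apply: cvg_cst]. Qed.

(** Retraction of the line onto [0, 1], used to make paths that are only known
    to be continuous within [0, 1] continuous everywhere. *)
Definition clamp (t : R) : R := Num.max 0 (Num.min t 1).

Lemma clamp_itv t : clamp t \in `[0, 1].
Proof.
by rewrite in_itv/= /clamp le_max lexx/= ge_max ler01/= ge_min lexx orbT.
Qed.

Lemma clamp_id t : t \in `[0, 1] -> clamp t = t.
Proof. by rewrite in_itv/= => /andP[t0 t1]; rewrite /clamp min_l// max_r. Qed.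

Lemma continuous_clamp : continuous clamp.
Proof.
move=> t; apply: (@continuous_max R R (cst 0) (id \min cst 1) t).
  exact: cvg_cst.
by apply: (@continuous_min R R id (cst 1) t); [exact: cvg_id|exact: cvg_cst].
Qed.

Lemma continuous_comp_clamp (c : R -> T) :
  {within `[0, 1], continuous c} -> continuous (c \o clamp).
Proof.
move=> /continuous_closedP cc; apply/continuous_closedP => W /cc.
move=> /closed_subspaceP[V cV VE].
have -> : (c \o clamp) @^-1` W = clamp @^-1` V.
  apply/seteqP; split=> t /=; have /= t01 := clamp_itv t.
    by move=> Wt; have : (c @^-1` W `&` `[0, 1]) (clamp t) by []; rewrite -VE => -[].
  by move=> Vt; have : (V `&` `[0, 1]) (clamp t) by []; rewrite VE => -[].
by move/continuous_closedP: continuous_clamp; exact.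
Qed.

Lemma continuous_glue c1 c2 (t0 : R) : continuous c1 -> continuous c2 ->
  c1 t0 = c2 t0 -> continuous (fun t => if t <= t0 then c1 t else c2 t).
Proof.
move=> cc1 cc2 c12; set c := fun t => _.
apply/continuous_subspace_setT.
have -> : setT = [set t : R | t <= t0] `|` [set t | t0 <= t].
  by apply/seteqP; split=> // t _ /=; case: (leP t t0) => [|/ltW]; [left|right].
apply: withinU_continuous; [exact: closed_le|exact: closed_ge| |].
- apply: (@subspace_eq_continuous _ _ _ c1); last exact: continuous_subspaceT.
  by move=> t /set_mem/= tt0; rewrite /from_subspace /c tt0.
- apply: (@subspace_eq_continuous _ _ _ c2); last exact: continuous_subspaceT.
  move=> t /set_mem/= tt0; rewrite /from_subspace /c; case: ifPn => // tt0'.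
  by have -> : t = t0 by apply/eqP; rewrite eq_le tt0 tt0'.
Qed.

Lemma closed_singleton x : closed [set x].
Proof.
by apply: compact_closed; [exact: metric_hausdorff|exact: compact_set1].
Qed.

Lemma closed_image_itv c (a b : R) : continuous c -> closed (c @` `[a, b]).
Proof.
move=> cc; apply: compact_closed; first exact: metric_hausdorff.
by apply: continuous_compact; [exact: continuous_subspaceT|exact: segment_compact].
Qed.

Lemma connected_image_itv c (a b : R) : continuous c -> connected (c @` `[a, b]).
Proof.
move=> cc; apply: connected_continuous_connected; last exact: continuous_subspaceT.
exact: segment_connected.
Qed.

(** The inverse is continuous because c maps closed subsets of the compact
    interval to compact, hence closed, sets. *)
Lemma homeomorphism_on_itv01 c : continuous c -> {in `[0, 1] &, injective c} ->
  homeomorphism_on (`[0, 1] : set R) (c @` `[0, 1]) c.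
Proof.
move=> cc ic.
have ic' : {in `[0, 1]%classic &, injective c}.
  by move=> s t; rewrite !inE; exact: ic.
split; [split=> //|exact: continuous_subspaceT|].
pose h y := xget 0 [set t | t \in `[0, 1] /\ c t = y].
have hK t : t \in `[0, 1] -> h (c t) = t.
  move=> t01; rewrite /h; case: xgetP => [s _ [s01 cst]|/(_ t)]; last by case.
  exact: ic.
exists h; last by move=> t; rewrite inE => /hK.
apply/continuous_closedP => W cW; apply/closed_subspaceP.
exists (c @` (W `&` `[0, 1])).
  apply: compact_closed; first exact: metric_hausdorff.
  apply: continuous_compact; first exact: continuous_subspaceT.
  by rewrite setIC; apply: compact_closedI => //; exact: segment_compact.
rewrite /from_subspace; apply/seteqP; split=> y /= [].
  by move=> [t [Wt t01] <-] _; split; [rewrite hK|exists t].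
move=> Wy [t t01 ty]; move: Wy; rewrite -ty hK// => Wt.
by split; exists t.
Qed.

Lemma arc_between_image c (a b : R) : a < b -> continuous c ->
  {in `[a, b] &, injective c} -> arc_between R (c a) (c b) (c @` `[a, b]).
Proof.
move=> ab cc ic; pose r (t : R) := (b - a) * t + a.
have cr : continuous (c \o r).
  by move=> t; apply: continuous_comp; [exact: continuous_affine|exact: cc].
have rI t : t \in `[0, 1] -> r t \in `[a, b].
  rewrite !in_itv/= /r => /andP[t0 t1]; have ba : 0 < b - a by lra.
  by apply/andP; split; nra.
have -> : c @` `[a, b] = (c \o r) @` `[0, 1].
  apply/seteqP; split=> _ [t tI <-]; last by exists (r t) => //; exact: rI.
  exists ((t - a) / (b - a)); last first.
    by rewrite /= /r mulrC divfK ?subrK// subr_eq0 gt_eqF.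
  move: tI; rewrite /= !in_itv/= => /andP[a_t t_b].
  have ba : 0 < b - a by lra.
  by rewrite divr_ge0 ?subr_ge0 ?(ltW ab)//= ler_pdivrMr// mul1r lerB.
exists (c \o r); split; last 2 first.
- by rewrite /= /r mulr0 add0r.
- by rewrite /= /r mulr1 subrK.
apply: homeomorphism_on_itv01 => // s t s01 t01 /(ic _ _ (rI _ s01) (rI _ t01)).
by move=> /addIr/mulfI; apply; rewrite subr_eq0 gt_eqF.
Qed.

Lemma arc_between_param x y (I : set T) : arc_between R x y I ->
  exists c, [/\ continuous c, {in `[0, 1] &, injective c}, c 0 = x, c 1 = y
    & c @` `[0, 1] = I].
Proof.
case=> g [[[gI ig sg] cg _] g0 g1]; exists (g \o clamp).
have in0 : (0 : R) \in `[0, 1] by rewrite in_itv/= lexx ler01.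
have in1 : (1 : R) \in `[0, 1] by rewrite in_itv/= lexx ler01.
split.
- exact: continuous_comp_clamp.
- by move=> s t s01 t01; rewrite /= !clamp_id//; apply: ig; rewrite inE.
- by rewrite /= clamp_id.
- by rewrite /= clamp_id.
- apply/seteqP; split=> [_ [t t01 <-]|y' /sg[t t01 <-]].
    by rewrite /= clamp_id//; exact: gI.
  by exists t; rewrite //= clamp_id.
Qed.

End Paths.

(** * Connected subsets of a tree contain the arcs between their points *)

Section Tree.
Context {R : realType} {T : metricType R}.
Implicit Types (x y z u v w : T) (c : R -> T).

(** Being joined by an arc in the complement of z.  Taking a = b makes every
    point other than z related to itself, and the choice of the parameter
    interval absorbs the reparametrizations needed for concatenation. *)
Definition arc_avoiding z u v := exists c (a b : R),
  [/\ a <= b, continuous c, {in `[a, b] &, injective c}, c a = u /\ c b = v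
    & ~ (c @` `[a, b]) z].

Lemma arc_avoiding_sym z u v : arc_avoiding z u v -> arc_avoiding z v u.
Proof.
move=> [c [a [b [ab cc ic [ca cb] zc]]]]; exists (c \o -%R), (- b), (- a).
have cN : continuous (c \o -%R).
  by move=> t; apply: continuous_comp; [exact: oppr_continuous|exact: cc].
have NI t : t \in `[- b, - a] -> - t \in `[a, b].
  by rewrite !in_itv/= => /andP[bt ta]; apply/andP; split; lra.
split; rewrite /= ?opprK//; first by lra.
  by move=> s t /NI sI /NI tI /= /(ic _ _ sI tI)/oppr_inj.
by case=> t /NI tI /= ctz; apply: zc; exists (- t).
Qed.

(** Follow the first arc only until it first meets the second one, then follow
    the second: stopping at the first meeting keeps the concatenation injective. *)
Lemma arc_avoiding_trans z u v w :
  arc_avoiding z u v -> arc_avoiding z v w -> arc_avoiding z u w.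
Proof.
move=> [c1 [a1 [b1 [ab1 cc1 ic1 [c1a c1b] zc1]]]].
move=> [c2 [a2 [b2 [ab2 cc2 ic2 [c2a c2b] zc2]]]].
pose H := `[a1, b1]%classic `&` c1 @^-1` (c2 @` `[a2, b2]).
have cH : compact H.
  apply: compact_closedI; first exact: segment_compact.
  by move/continuous_closedP: cc1; apply; exact: closed_image_itv.
have H0 : H !=set0.
  exists b1; split; first by rewrite /= in_itv/= ab1 lexx.
  by exists a2; rewrite ?c2a//= in_itv/= lexx.
have [|t0 /set_mem[+ [s0 /= s0I c2s0]] t0min] := compact_EVT_min H0 cH (f := id).
  by apply: continuous_subspaceT => t; exact: cvg_id.
rewrite /= in_itv/= => /andP[at0 t0b].
have /andP[as0 s0b] : a2 <= s0 <= b2 by move: s0I; rewrite in_itv.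
(* The second path, shifted in time so as to be at the meeting point at t0. *)
pose d t := c2 (1 * t + (s0 - t0)).
have cd : continuous d.
  by move=> t; apply: continuous_comp; [exact: continuous_affine|exact: cc2].
have dI t : t \in `[a1, t0 + (b2 - s0)] -> t0 < t -> 1 * t + (s0 - t0) \in `[a2, b2].
  by rewrite !in_itv/= => /andP[? ?] ?; apply/andP; split; lra.
have cI t : t \in `[a1, t0 + (b2 - s0)] -> t <= t0 -> t \in `[a1, b1].
  by rewrite !in_itv/= => /andP[? ?] ?; apply/andP; split; lra.
have cross s t : s \in `[a1, t0 + (b2 - s0)] -> t \in `[a1, t0 + (b2 - s0)] ->
    s <= t0 -> t0 < t -> c1 s <> d t.
  move=> sI tI st tt st_eq; have sI1 := cI _ sI st; have tI2 := dI _ tI tt.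
  have t0s : t0 <= s.
    apply: t0min; apply/mem_set; split => //.
    by rewrite /= st_eq; exists (1 * t + (s0 - t0)).
  have s_t0 : s = t0 by apply/eqP; rewrite eq_le st.
  by move: st_eq; rewrite s_t0 -c2s0 => /(ic2 _ _ s0I tI2); lra.
exists (fun t => if t <= t0 then c1 t else d t), a1, (t0 + (b2 - s0)).
split.
- by lra.
- by apply: continuous_glue => //; rewrite /d -c2s0; congr c2; lra.
- move=> s t sI tI; case: (leP s t0) => ss; case: (leP t t0) => tt //.
  + exact: ic1 (cI _ sI ss) (cI _ tI tt).
  + by move=> /(cross _ _ sI tI ss tt).
  + by move=> /esym/(cross _ _ tI sI tt ss).
  + by move=> /(ic2 _ _ (dI _ sI ss) (dI _ tI tt)); lra.
- split; first by rewrite at0.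
  case: ifPn => [le0|]; last by rewrite /d -c2b => _; congr c2; lra.
  have sb : s0 = b2 by lra.
  by rewrite -c2b -sb subrr addr0 c2s0.
- case=> t tI; case: ifPn => [tt|]; last rewrite -ltNge => tt.
    by move=> ctz; apply: zc1; exists t => //; exact: cI tt.
  by move=> ctz; apply: zc2; exists (1 * t + (s0 - t0)) => //; exact: dI tt.
Qed.

(** By uniqueness, every arc from x to y has image I. *)
Lemma arc_separates x y z (I : set T) :
  uniquely_arcwise_connected R T -> x <> y ->
  arc_between R x y I -> I z -> ~ arc_avoiding z x y.
Proof.
move=> uac xy arcI Iz [c [a [b [ab cc ic [ca cb]]]]]; apply.
have {}ab : a < b.
  by rewrite lt_neqAle ab andbT; apply/eqP => ab'; apply: xy; rewrite -ca -cb ab'.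
have [J [_ uJ]] := uac _ _ xy.
have := arc_between_image ab cc ic; rewrite ca cb => /uJ <-.
by rewrite (uJ _ arcI).
Qed.

Hypothesis tree : is_tree R T.

Lemma tree_cover : (exists x : T, forall y, y = x) \/
  exists2 F : set (set T), finite_set F &
    (forall y, exists2 I, F I & I y) /\
    (forall I, F I -> exists c, [/\ continuous c, {in `[0, 1] &, injective c}
       & c @` `[0, 1] = I]).
Proof.
have [_ [[x Tx]|[F [finF _ FI covF]]]] := tree; [left|right].
  by exists x => y; have : [set: T] y by []; rewrite Tx.
exists F => //; split=> [y|I /FI[g gI]].
  by have : [set: T] y by []; rewrite -covF => -[I FI' Iy]; exists I.
have arcI : arc_between R (g 0) (g 1) I by exists g.
by have [c [cc ic _ _ cI]] := arc_between_param arcI; exists c.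
Qed.

Lemma subarc_avoiding z c (a b : R) : continuous c ->
  {in `[0, 1] &, injective c} -> 0 <= a -> a <= b -> b <= 1 ->
  ~ (c @` `[a, b]) z -> arc_avoiding z (c a) (c b).
Proof.
move=> cc ic a0 ab b1 zc; exists c, a, b; split=> // s t.
rewrite !in_itv/= => /andP[? ?] /andP[? ?]; apply: ic; rewrite in_itv/=; lra.
Qed.

(** A subarc on which z can occur only as an endpoint stays in one class once z
    is removed, so a saturated set either contains it, up to z, or misses it. *)
Lemma closed_saturated_piece z c (a b : R) (S : set T) : continuous c ->
  {in `[0, 1] &, injective c} -> 0 <= a -> b <= 1 ->
  (forall t, t \in `[a, b] -> c t = z -> t = a \/ t = b) ->
  (forall u v, arc_avoiding z u v -> S u -> S v) ->
  closed ([set z] `|` (S `&` c @` `[a, b])).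
Proof.
move=> cc ic a0 b1 zab Ssat.
have cz : closed [set z] by exact: closed_singleton.
have sat s t : s \in `[a, b] -> t \in `[a, b] -> s <= t -> c s <> z -> c t <> z ->
    arc_avoiding z (c s) (c t).
  rewrite !in_itv/= => /andP[? ?] /andP[? ?] st csz ctz.
  apply: subarc_avoiding => //; try lra.
  case=> r /=; rewrite in_itv/= => /andP[? ?] crz.
  have rI : r \in `[a, b] by rewrite in_itv/=; lra.
  have [rE|rE] := zab r rI crz.
    by apply: csz; rewrite -crz; congr c; lra.
  by apply: ctz; rewrite -crz; congr c; lra.
have [[t [tI ctz St]]|noS] :=
    pselect (exists t, [/\ t \in `[a, b], c t <> z & S (c t)]).
  have -> : [set z] `|` (S `&` c @` `[a, b]) = [set z] `|` c @` `[a, b].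
    apply/seteqP; split=> [y [->|[_ cy]]|y [->|[s sI <-]]];
      [by left|by right|by left|].
    have [->|csz] := eqVneq (c s) z; first by left.
    right; split; last by exists s.
    have [st|/ltW ts] := leP s t.
      by apply: Ssat St; apply/arc_avoiding_sym/sat => //; exact/eqP.
    by apply: Ssat St; apply/sat => //; exact/eqP.
  by apply: closedU => //; exact: closed_image_itv.
have -> : [set z] `|` (S `&` c @` `[a, b]) = [set z] => //.
apply/seteqP; split=> [y [->//|[Sy [t tI cty]]]|y ->]; last by left.
by apply: contrapT => yz; apply: noS; exists t; split=> //; rewrite cty.
Qed.

(** Each of the finitely many intervals covering the tree is cut at z into at
    most two subarcs, to which the previous lemma applies. *)
Lemma closed_saturated z (S : set T) :
  (forall u v, arc_avoiding z u v -> S u -> S v) -> closed ([set z] `|` S).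
Proof.
move=> Ssat.
have cz : closed [set z] by exact: closed_singleton.
have [[x Tx]|[F finF [covF FI]]] := tree_cover.
  have [->|/set0P[y Sy]] := eqVneq S set0; first by rewrite setU0.
  rewrite (_ : _ `|` _ = setT); first exact: closedT.
  by apply/seteqP; split=> // w _; left; rewrite /= (Tx w) (Tx z).
have -> : [set z] `|` S = [set z] `|` \bigcup_(I in F) ([set z] `|` (S `&` I)).
  apply/seteqP; split=> [y [->|Sy]|y [->|[I FI' [->|[Sy _]]]]]; try by left.
    by right; have [I FI' Iy] := covF y; exists I => //; right.
  by right.
apply: closedU => //; apply: closed_bigcup => // I /FI[c [cc ic <-]].
have [r [r0 r1 rz]] : exists r : R, [/\ 0 <= r, r <= 1 &
    forall t, t \in `[0, 1] -> c t = z -> t = r].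
  (* When z is not on the interval, any cutting point will do. *)
  have [[r rI crz]|noz] := pselect (exists2 r : R, r \in `[0, 1] & c r = z).
    exists r; move: (rI); rewrite in_itv/= => /andP[? ?]; split=> // t tI ctz.
    by apply: ic => //; rewrite ctz.
  by exists 0; split=> // t tI ctz; exfalso; apply: noz; exists t.
have -> : [set z] `|` (S `&` c @` `[0, 1]) =
    ([set z] `|` (S `&` c @` `[0, r])) `|` ([set z] `|` (S `&` c @` `[r, 1])).
  apply/seteqP; split=> [y [->|[Sy [t tI cty]]]
                        |y [[->|[Sy [t tI cty]]]|[->|[Sy [t tI cty]]]]].
  - by left; left.
  - move: tI; rewrite /= in_itv/= => /andP[t0 t1].
    have [tr|/ltW rt] := leP t r; [left|right]; right; split=> //;
      by exists t => //=; rewrite in_itv/=; apply/andP.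
  - by left.
  - right; split=> //; exists t => //=; move: tI; rewrite /= !in_itv/=.
    by move=> /andP[? ?]; lra.
  - by left.
  - right; split=> //; exists t => //=; move: tI; rewrite /= !in_itv/=.
    by move=> /andP[? ?]; lra.
apply: closedU; apply: closed_saturated_piece => //.
  move=> t; rewrite in_itv/= => /andP[? ?] ctz; right; apply: rz ctz.
  by rewrite in_itv/=; lra.
move=> t; rewrite in_itv/= => /andP[? ?] ctz; left; apply: rz ctz.
by rewrite in_itv/=; lra.
Qed.

(** If z on the arc were not in S, the class of x in the complement of z and
    the complementary union of classes would both be closed up to z, hence would
    disconnect S: the point y is not in the class of x by uniqueness of arcs. *)
Lemma arc_sub_connected x y (I S : set T) : x <> y -> arc_between R x y I ->
  connected S -> S x -> S y -> I `<=` S.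
Proof.
move=> xy arcI cS Sx Sy z Iz; apply: contrapT => Sz.
pose U := [set u | arc_avoiding z x u].
have satU u v : arc_avoiding z u v -> U u -> U v.
  by move=> uv xu; exact: arc_avoiding_trans uv.
have satV u v : arc_avoiding z u v -> (~` U) u -> (~` U) v.
  by move=> uv nxu xv; apply: nxu; apply: satU xv; exact: arc_avoiding_sym.
have Ux : U x.
  exists (cst x), 0, 0; split=> //.
  - exact: cst_continuous.
  - by move=> s t; rewrite !in_itv/=; lra.
  - by case=> t _ /= xz; apply: Sz; rewrite -xz.
suff SU : S `&` U = S.
  by case: (arc_separates tree.1 xy arcI Iz); have := Sy; rewrite -SU => -[].
apply: cS; first by exists x.
- exists (~` ([set z] `|` ~` U)).
    exact/closed_openC/closed_saturated.
  rewrite setCU setCK; apply/seteqP; split=> u [Su Uu]; split=> //; last by case: Uu.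
  by split=> // uz; apply: Sz; rewrite -uz.
- exists ([set z] `|` U); first exact: closed_saturated.
  apply/seteqP; split=> u [Su Uu]; split=> //; first by right.
  by case: Uu => // uz; case: Sz; rewrite -uz.
Qed.

End Tree.

(** * Spokes and stars *)

Section Spokes.
Context {R : realType} {T : metricType R}.
Implicit Types (x y z : T) (c : R -> T).

(** The last clause is the form in which arcs from x enter the dynamics; unlike
    injectivity, it also holds for the constant path, which serves as the
    degenerate spoke from x to itself. *)
Definition spoke x c := [/\ continuous c, c 0 = x &
  forall (S : set T), connected S -> S x ->
    forall s t : R, 0 <= s -> s <= t -> t <= 1 -> S (c t) -> S (c s)].

Hypothesis tree : is_tree R T.

Lemma spoke_to x y : exists2 c, spoke x c & c 1 = y.
Proof.
have [->|/eqP xy] := eqVneq x y.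
  by exists (cst y) => //; split=> //; exact: cst_continuous.
have uac := tree.1; have [I [arcI _]] := uac x y xy.
have [c [cc ic c0 c1 _]] := arc_between_param arcI.
exists c => //; split=> // S cS Sx s t s0 st t1 St.
have [->//|t0] := eqVneq s t.
have {}st : s < t by rewrite lt_neqAle t0.
have ct : x <> c t.
  by rewrite -c0 => /ic; rewrite !in_itv/=; lra.
have arct : arc_between R x (c t) (c @` `[0, t]).
  rewrite -c0; apply: arc_between_image => //; first by lra.
  move=> u v; rewrite !in_itv/= => /andP[? ?] /andP[? ?].
  by apply: ic; rewrite in_itv/=; lra.
apply: (arc_sub_connected tree ct arct cS Sx St).
by exists s => //=; rewrite in_itv/=; lra.
Qed.

(** The spokes ending at the two endpoints of an interval have a connected
    union containing both endpoints, hence the whole interval; so the spokes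
    to the endpoints of the intervals that make up the tree suffice. *)
Lemma spoke_cover x : exists (J : finType) (c : J -> R -> T),
  (forall j, spoke x (c j)) /\
  (forall y, exists j, exists2 t : R, t \in `[0, 1] & c j t = y).
Proof.
have /choice[c cP] : forall y, exists c, spoke x c /\ c 1 = y.
  by move=> y; have [c] := spoke_to x y; exists c.
have in0 : (0 : R) \in `[0, 1] by rewrite in_itv/= lexx ler01.
have in1 : (1 : R) \in `[0, 1] by rewrite in_itv/= lexx ler01.
have [[x0 Tx0]|[F /finite_seqP[s Fs] [covF FI]]] := tree_cover tree.
  exists unit, (fun=> c x); split=> [_|y]; first by case: (cP x).
  by exists tt, 0 => //; rewrite (Tx0 y) (Tx0 (c x 0)).
have /choice[g gP] : forall I, exists g : R -> T, F I ->
    [/\ continuous g, {in `[0, 1] &, injective g} & g @` `[0, 1] = I].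
  move=> I; have [/FI[g gI]|nFI] := pselect (F I); first by exists g.
  by exists (cst x).
(* The boolean selects one of the two endpoints, via its image in R. *)
exists ('I_(size s) * bool)%type,
  (fun k : 'I_(size s) * bool => c (g (nth set0 s k.1) k.2%:R)).
split=> [k|y]; first by case: (cP (g (nth set0 s k.1) k.2%:R)).
have [I FI' Iy] := covF y; have [cg ig gI] := gP I FI'.
have Is : I \in s by move: FI'; rewrite Fs.
have Ik : (index I s < size s)%N by rewrite index_mem.
pose D (b : bool) := c (g I b%:R) @` `[0, 1].
have cD b : connected (D b).
  by apply: connected_image_itv; case: (cP (g I b%:R)) => -[].
have Dx b : D b x by exists 0 => //; case: (cP (g I b%:R)) => -[].
have Dg b : D b (g I b%:R) by exists 1 => //; case: (cP (g I b%:R)).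
have g01 : g I 0 <> g I 1 by move=> /(ig _ _ in0 in1)/eqP; rewrite lt_eqF.
have arcI := arc_between_image ltr01 cg ig.
have : (D false `|` D true) y.
  apply: (arc_sub_connected tree g01 arcI); last by rewrite gI.
  - by apply: connectedU => //; exists x.
  - by left; exact: (Dg false).
  - by right; exact: (Dg true).
have at_k (b : bool) : D b y -> exists j : 'I_(size s) * bool, exists2 t : R,
    t \in `[0, 1] & c (g (nth set0 s j.1) j.2%:R) t = y.
  by move=> [t tI cty]; exists (Ordinal Ik, b), t => //=; rewrite nth_index.
by case=> /at_k.
Qed.

Lemma hausdorff_dist_le (A B : set T) (e : R) : A !=set0 -> B !=set0 ->
  (forall a, A a -> exists2 b, B b & mdist a b <= e) ->
  (forall b, B b -> exists2 a, A a & mdist a b <= e) ->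
  `|hausdorff_dist A B| <= e.
Proof.
move=> A0 B0 AB BA.
have half (X Y : set T) (d : T -> T -> R) : X !=set0 ->
    (forall a b, 0 <= d a b) ->
    (forall a, X a -> exists2 b, Y b & d a b <= e) ->
    0 <= sup [set inf [set d a b | b in Y] | a in X] <= e.
  move=> X0 d0 XY.
  have inf_le a : X a -> 0 <= inf [set d a b | b in Y] <= e.
    move=> /XY[b Yb de]; apply/andP; split.
      by apply: lb_le_inf; [exists (d a b), b|move=> _ [b' _ <-]].
    apply: le_trans de; apply: ge_inf; last by exists b.
    by exists 0 => _ [b' _ <-].
  have ube : ubound [set inf [set d a b | b in Y] | a in X] e.
    by move=> _ [a /inf_le/andP[_ ?] <-].
  have [a Xa] := X0; apply/andP; split.
    have /andP[ge0 _] := inf_le a Xa; apply: (le_trans ge0).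
    by apply: ub_le_sup; [exists e|exists a].
  by apply: ge_sup => //; exists (inf [set d a b | b in Y]), a.
have /andP[l1 u1] := half A B (@mdist _ T) A0 (fun a b => mdist_ge0 a b) AB.
have /andP[l2 u2] :=
  half B A (fun b a => mdist a b) B0 (fun a b => mdist_ge0 b a) BA.
by rewrite /hausdorff_dist ger0_norm ?ge_max ?u1 ?u2// le_max l1.
Qed.

Section Star.
Variables (x : T) (J : finType) (c : J -> R -> T).
Hypothesis spoke_c : forall j, spoke x (c j).
Hypothesis cover_c : forall y, exists j, exists2 t : R, t \in `[0, 1] & c j t = y.

Definition star (r : J -> R) : set T := \bigcup_j (c j @` `[0, r j]).

Lemma star_center r : (forall j, 0 <= r j) -> star r x.
Proof.
move=> r0; have [j _] := cover_c x; exists j => //; exists 0.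
  by rewrite /= in_itv/= lexx r0.
by case: (spoke_c j).
Qed.

Lemma star_subcontinuum r : (forall j, 0 <= r j) -> subcontinuum (star r).
Proof.
move=> r0; split; first by exists x; exact: star_center.
- rewrite /star -bigsetU_fset_set; last exact: finite_finset.
  apply: bigsetU_compact => j _.
  apply: continuous_compact; last exact: segment_compact.
  by apply: continuous_subspaceT; case: (spoke_c j).
- apply: bigcup_connected.
    exists x => j _; exists 0; first by rewrite /= in_itv/= lexx r0.
    by case: (spoke_c j).
  by move=> j _; apply: connected_image_itv; case: (spoke_c j).
Qed.

(** Where the segments [0, r n j] and [0, l j] differ, the parameter lies
    between r n j and l j, so continuity of the spokes at the limit extents is
    enough. *)
Lemma cvg_star (r : nat -> J -> R) (l : J -> R) :
  (forall n j, 0 <= r n j) ->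
  (forall j, (fun n => r n j) @ \oo --> l j) ->
  (fun n => hausdorff_dist (star (r n)) (star l)) @ \oo --> (0 : R).
Proof.
move=> r0 rl.
have l0 j : 0 <= l j.
  rewrite -(cvg_lim (@Rhausdorff R) (rl j)); apply: limr_ge.
    by apply/cvg_ex; exists (l j).
  by near=> n; exact: r0.
apply/cvgr0Pnorm_le => e e0; have e20 : 0 < e / 2 by lra.
have /choice[d dP] : forall j, exists d : R, 0 < d /\
    forall t, `|l j - t| < d -> mdist (c j (l j)) (c j t) < e / 2.
  move=> j; have [cc _ _] := spoke_c j.
  have /metricType_numDomainType.cvgr_dist_lt/(_ _ e20) := cc (l j).
  by move=> /nbhs_ballP[d /= d0 dP]; exists d.
have near_r : \forall n \near \oo, forall j, `|l j - r n j| < d j.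
  apply: filter_forall => j; have [d0 _] := dP j.
  by have /cvgrPdist_lt/(_ _ d0) := rl j.
near=> n; have rn_close : forall j, `|l j - r n j| < d j by near: n.
have close j t : Num.min (l j) (r n j) <= t -> t <= Num.max (l j) (r n j) ->
    mdist (c j (l j)) (c j t) < e / 2.
  have [_ dj] := dP j; move=> h1 h2; apply: dj; have := rn_close j.
  move: h1 h2; rewrite /Num.min /Num.max; case: ltP => _ h1 h2.
    by rewrite !ltr_norml; lra.
  by rewrite !ltr_norml; lra.
apply: hausdorff_dist_le.
- by exists x; exact: star_center.
- by exists x; exact: star_center.
- move=> _ [j _ [t /= + <-]]; rewrite in_itv/= => /andP[t0 tr].
  have [tl|lt] := leP t (l j).
    exists (c j t); last by rewrite mdistxx ltW.
    by exists j => //; exists t; rewrite //= in_itv/= t0.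
  exists (c j (l j)).
    by exists j => //; exists (l j); rewrite //= in_itv/= lexx l0.
  rewrite metric_sym ltW// (lt_trans (close j t _ _))//; first by rewrite ge_min ltW.
    by rewrite le_max tr orbT.
  by lra.
- move=> _ [j _ [t /= + <-]]; rewrite in_itv/= => /andP[t0 tl].
  have [tr|rt] := leP t (r n j).
    exists (c j t); last by rewrite mdistxx ltW.
    by exists j => //; exists t; rewrite //= in_itv/= t0.
  exists (c j (r n j)).
    by exists j => //; exists (r n j); rewrite //= in_itv/= lexx r0.
  rewrite (le_trans (metric_triangle _ (c j (l j)) _))// [leRHS](splitr e) lerD//.
    rewrite metric_sym ltW// close//; first by rewrite ge_min lexx orbT.
    by rewrite le_max lexx orbT.
  rewrite ltW// close//; first by rewrite ge_min (ltW rt) orbT.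
  by rewrite le_max tl.
Unshelve. all: by end_near. Qed.

(** Connectedness makes the trace of S on each spoke an initial segment, and
    closedness makes the extent attained. *)
Lemma extents_exist (S : set T) : closed S -> connected S -> S x ->
  exists r : J -> R, S = star r /\ forall j, [/\ 0 <= r j, r j <= 1 &
    forall t : R, 0 <= t -> t <= 1 -> S (c j t) <-> t <= r j].
Proof.
move=> clS cS Sx.
have /choice[r rP] : forall j, exists t : R, [/\ 0 <= t, t <= 1 &
    forall s : R, 0 <= s -> s <= 1 -> S (c j s) <-> s <= t].
  move=> j; have [cc c0 down] := spoke_c j.
  pose H := `[0, 1]%classic `&` c j @^-1` S.
  have cH : compact H.
    apply: compact_closedI; first exact: segment_compact.
    by move/continuous_closedP: cc; apply.
  have H0 : H !=set0.
    by exists 0; split; rewrite /= ?c0//= in_itv/= lexx ler01.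
  have [|t /set_mem[+ St] tmax] := compact_EVT_max H0 cH (f := id).
    by apply: continuous_subspaceT => t; exact: cvg_id.
  rewrite /= in_itv/= => /andP[t0 t1]; exists t; split=> // s s0 s1; split=> [Ss|st].
    by apply: tmax; apply/mem_set; split=> //; rewrite /= in_itv/= s0.
  exact: down St.
exists r; split=> //; apply/seteqP; split=> [y Sy|_ [j _ [t /= + <-]]].
  have [j [t tI cty]] := cover_c y; exists j => //; exists t => //=.
  move: tI; rewrite !in_itv/= => /andP[t0 t1]; rewrite t0/=.
  by have [_ _ rj] := rP j; apply/rj => //; rewrite cty.
rewrite in_itv/= => /andP[t0 tr]; have [_ r1 rj] := rP j.
by apply/rj => //; exact: le_trans r1.
Qed.

End Star.
End Spokes.

(** The tips of the images of A have dominating predecessors: the tip on spoke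
    i at time n + 1 is the image of a point at parameter t on some spoke j, and
    this point belongs to every image of A whose extent on j is at least t. *)
Lemma asymptotically_periodic_fixed (R : realType) (T : metricType R) (g : T -> T)
    (x : T) (A : set T) :
  is_tree R T -> continuous g -> g x = x -> subcontinuum A -> A x ->
  asymptotically_periodic g A.
Proof.
move=> tree cg gx [_ cpA cA] Ax.
have [J [c [spoke_c cover_c]]] := spoke_cover tree x.
have cgn n : continuous (iter n g).
  elim: n => [|n IHn] t; first exact: cvg_id.
  by apply: continuous_comp; [exact: IHn|exact: cg].
have gnx n : iter n g x = x by elim: n => //= n ->.
have /choice[r rP] : forall n, exists r : J -> R, iter n g @` A = star c r /\
    forall j, [/\ 0 <= r j, r j <= 1 & forall t : R, 0 <= t -> t <= 1 ->
      (iter n g @` A) (c j t) <-> t <= r j].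
  move=> n; apply: extents_exist spoke_c cover_c _ _ _ _.
  - apply: compact_closed; first exact: metric_hausdorff.
    by apply: continuous_compact => //; exact: continuous_subspaceT.
  - by apply: connected_continuous_connected => //; exact: continuous_subspaceT.
  - by exists x.
have r0 n j : 0 <= r n j by have [_ /(_ j)[]] := rP n.
have r1 n j : r n j <= 1 by have [_ /(_ j)[]] := rP n.
have rE n j (t : R) : 0 <= t -> t <= 1 -> (iter n g @` A) (c j t) <-> t <= r n j.
  by have [_ /(_ j)[_ _ h]] := rP n; exact: h.
have pred_ex n i : exists j, forall n', r n j <= r n' j -> r n.+1 i <= r n'.+1 i.
  have [a Aa /= ga] : (iter n.+1 g @` A) (c i (r n.+1 i)) by apply/rE.
  have [j [t + cjt]] := cover_c (iter n g a); rewrite in_itv/= => /andP[t0 t1].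
  have tr : t <= r n j by apply/rE => //; exists a.
  exists j => n' rjn; have [b Ab gb] : (iter n' g @` A) (c j t).
    by apply/rE => //; exact: le_trans rjn.
  by apply/rE => //; exists b => //=; rewrite gb cjt.
exists (#|J|)`! => [|]; first exact: fact_gt0.
have /choice[l lP] : forall j, exists l : R,
    (fun n => r ((#|J|)`! * n)%N j) @ \oo --> l.
  move=> j; apply/cvg_ex/(cvgn_dominating_pred (M := 1)) => // n k.
  by rewrite ger0_norm.
have l0 j : 0 <= l j.
  rewrite -(cvg_lim (@Rhausdorff R) (lP j)); apply: limr_ge.
    by apply/cvg_ex; exists (l j).
  by near=> n; exact: r0.
exists (star c l); first exact: star_subcontinuum spoke_c cover_c _ l0.
under eq_fun do rewrite (rP _).1.
exact: (cvg_star spoke_c cover_c (r := fun n => r ((#|J|)`! * n)%N)).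
Unshelve. all: by end_near. Qed.

Theorem theorem1 (R : realType) (T : metricType R) (f : T -> T) (A : set T) :
  is_tree R T -> continuous f -> subcontinuum A ->
  (exists2 x : T, A x & periodic_point f x) ->
  asymptotically_periodic f A.
Proof.
move=> tree cf conA [x Ax [k k1 fx]].
have cfk : continuous (iter k f).
  elim: (k) => [|n IHn] t; first exact: cvg_id.
  by apply: continuous_comp; [exact: IHn|exact: cf].
have [p p1 [B conB cvB]] := asymptotically_periodic_fixed tree cfk fx conA Ax.
exists (p * k)%N; first by rewrite muln_gt0 p1.
exists B => //.
have -> : (fun n => hausdorff_dist (iter (p * k * n) f @` A) B) =
    (fun n => hausdorff_dist (iter (p * n) (iter k f) @` A) B).
  apply/funext => n; congr (hausdorff_dist (_ @` A) B); apply/funext => t.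
  by rewrite -iterM mulnAC.
exact: cvB.
Qed.
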